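(* There exist a reflexive Banach space $X$ and a nonempty family of generators $A:D(A)\subset X\to X$ of uniformly exponentially stable $C_0$-semigroups on $X$ such that, for each $A$ in the family, there is an $A$-bounded linear operator $B:D(A)\to X$ which is not $\theta$-subordinate to $A$ for any $\theta\in[0,1)$, while $A+B$ generates a $C_0$-semigroup on $X$ that is strongly stable but not uniformly exponentially stable.
   Context: A linear operator $B:D(B)\to X$ is $A$-bounded if $D(A)\subseteq D(B)$ and there are $a,b\ge0$ with $\|Bx\|\le a\|Ax\|+b\|x\|$ for all $x\in D(A)$. It is $\theta$-subordinate to $A$ (with $0\le\theta<1$) if $D(A)\subseteq D(B)$ and there is $c>0$ with $\|Bx\|\le c\,\|Ax\|^{\theta}\|x\|^{1-\theta}$ for all $x\in D(A)$ (for $\theta=0$ this reads $\|Bx\|\le c\|x\|$). The operator $A+B$ has domain $D(A)$. A $C_0$-semigroup $(T(t))_{t\ge0}$ is strongly stable if $\lim_{t\to\infty}\|T(t)x\|=0$ for all $x\in X$, and uniformly exponentially stable if there are $M\ge1$, $\omega>0$ with $\|T(t)\|_{\mathcal L(X)}\le Me^{-\omega t}$ for all $t\ge0$. *)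

(* Defs.v *)
From HB Require Import structures.
From mathcomp Require Import all_boot all_order all_algebra.
From mathcomp Require Import complex.
From mathcomp Require Import all_classical all_reals all_analysis.

Set Implicit Arguments.
Unset Strict Implicit.
Unset Printing Implicit Defensive.

Import Order.TTheory GRing.Theory Num.Theory.
Import numFieldNormedType.Exports.

Local Open Scope classical_set_scope.
Local Open Scope complex_scope.
Local Open Scope ring_scope.

(* Banach spaces are complex, i.e. objects of completeNormedModType R[i].  The
   norm of a normedModType over R[i] takes its values in R[i]; they are
   nonnegative reals, and [nrm] reads them in R. *)
Definition nrm (R : realType) (V : normedModType R[i]) (x : V) : R :=
  complex.Re `|x|.

(* Operator norm of a bounded linear map.  It must only be applied to bounded
   maps: [sup] returns 0 on sets that are not bounded above. *)
Definition opnorm (R : realType) (V W : normedModType R[i]) (f : V -> W) : R :=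
  sup [set nrm (f x) | x in [set x | nrm x <= 1]].

Definition topological_dual (R : realType) (X : normedModType R[i]) :
    set (X -> R[i]^o) :=
  [set f : X -> R[i]^o | linear f /\ continuous f].

(* Surjectivity of the canonical embedding of X into its bidual.  An element of
   the bidual is the restriction to [topological_dual X] of some [phi] which is
   linear and bounded there; values of [phi] elsewhere are irrelevant. *)
Definition reflexive_space (R : realType) (X : normedModType R[i]) : Prop :=
  forall phi : (X -> R[i]^o) -> R[i]^o,
    (forall (a : R[i]) f g, topological_dual f -> topological_dual g ->
      phi (fun x => a *: f x + g x) = a *: phi f + phi g) ->
    (exists M : R, forall f, topological_dual f ->
      nrm (phi f) <= M * opnorm f) ->
    exists x : X, forall f, topological_dual f -> phi f = f x.

(* A map A : D(A) -> X with D(A) included in X is encoded by a total function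
   together with D(A); its values outside D(A) are irrelevant. *)
Record operator (X : Type) := Operator { dom : set X ; app :> X -> X }.

Definition linear_operator (R : realType) (X : normedModType R[i])
    (A : operator X) : Prop :=
  dom A 0 /\
  forall (a : R[i]) x y, dom A x -> dom A y ->
    dom A (a *: x + y) /\ A (a *: x + y) = a *: A x + A y.

Definition op_add (R : realType) (X : normedModType R[i]) (A B : operator X) :
  operator X := Operator (dom A) (fun x => A x + B x).

Definition relatively_bounded (R : realType) (X : normedModType R[i])
    (A B : operator X) : Prop :=
  dom A `<=` dom B /\
  exists a b : R, [/\ 0 <= a, 0 <= b &
    forall x, dom A x -> nrm (B x) <= a * nrm (A x) + b * nrm x].

(* Since r `^ 0 = 1 for every r, including r = 0, the case theta = 0 reads
   nrm (B x) <= c * nrm x. *)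
Definition subordinate (R : realType) (X : normedModType R[i]) (theta : R)
    (A B : operator X) : Prop :=
  dom A `<=` dom B /\
  exists2 c : R, 0 < c &
    forall x, dom A x ->
      nrm (B x) <= c * nrm (A x) `^ theta * nrm x `^ (1 - theta).

(* Only the values T t with t >= 0 matter. *)
Definition C0_semigroup (R : realType) (X : normedModType R[i])
    (T : R -> X -> X) : Prop :=
  [/\ forall t, 0 <= t -> linear (T t) /\ continuous (T t),
      forall x, T 0 x = x,
      forall s t x, 0 <= s -> 0 <= t -> T (s + t) x = T s (T t x) &
      forall x, T t x @[t --> 0^'+] --> x].

Definition generates (R : realType) (X : normedModType R[i])
    (A : operator X) (T : R -> X -> X) : Prop :=
  [/\ C0_semigroup T,
      dom A = [set x | cvg ((t^-1)%:C *: (T t x - x) @[t --> 0^'+])] &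
      forall x, dom A x -> (t^-1)%:C *: (T t x - x) @[t --> 0^'+] --> A x].

Definition strongly_stable (R : realType) (X : normedModType R[i])
    (T : R -> X -> X) : Prop :=
  forall x, nrm (T t x) @[t --> +oo] --> 0.

Definition uniformly_exponentially_stable (R : realType)
    (X : normedModType R[i]) (T : R -> X -> X) : Prop :=
  exists M omega : R, [/\ 1 <= M, 0 < omega &
    forall t, 0 <= t -> opnorm (T t) <= M * expR (- omega * t)].

(* Main.v *)
From HB Require Import structures.
Require Import Defs.
From mathcomp Require Import all_boot all_order all_algebra.
From mathcomp Require Import complex.
From mathcomp Require Import all_classical all_reals all_analysis.
From mathcomp Require Import lra ring.
Import Order.TTheory GRing.Theory Num.Theory.
Import numFieldNormedType.Exports.
Local Open Scope classical_set_scope.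
Local Open Scope complex_scope.
Local Open Scope ring_scope.

Set Implicit Arguments.
Unset Strict Implicit.
Unset Printing Implicit Defensive.

(** The space is the complex sequence space l^2, and all operators are
    diagonal in its canonical basis.  The operator A has eigenvalues - a n and
    A + B has eigenvalues - m n, where

      a n = 1  and  m n = 1 / (n + 1)     for even n,
      a n = n + 1  and  m n = 2 (n + 1)   for odd n.

    The two parities do separate jobs.  On the even part everything is bounded,
    and B moves the spectrum of A from - 1 to a sequence of negative numbers
    tending to 0: this destroys uniform exponential stability but keeps strong
    stability.  On the odd part B equals A itself, which is unbounded; along
    the basis vectors of odd index the ratio of the norm of B e_n to the power
    theta of the norm of A e_n is (n + 1)^(1 - theta), so B is not
    theta-subordinate to A.  Since the modulus of a n - m n never exceeds
    a n, B is A-bounded; and a and m differ by bounded factors up to bounded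
    perturbations, so A and A + B have the same maximal domain.

    A diagonal operator with eigenvalues - m n <= 0 and maximal domain
    generates the semigroup of multiplication by exp (- m n t)
    (diag_semigroup_generates).  Strong continuity, the computation of the
    generator and strong stability all reduce to coordinatewise limits by a
    dominated convergence principle in l^2 (ell2_dominated_cvg0).

    Reflexivity (ell2_reflexive) is obtained from the coordinate
    functionals: the coefficients of a continuous linear form on the basis are
    square summable, its truncations converge to it in norm, and an element of
    the bidual is therefore determined by its values on the coordinate
    functionals, which are again square summable. *)

(** * Real-valued norms on complex normed spaces *)

Section real_norm.
Variables (R : realType) (V : normedModType R[i]).
Implicit Types x y : V.

Lemma normr_nrm x : `|x| = (nrm x)%:C.
Proof. by rewrite /nrm RRe_real// ger0_real. Qed.

Lemma nrm_ge0 x : 0 <= nrm x.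
Proof. by rewrite -ler0c -normr_nrm. Qed.

Lemma nrmD x y : nrm (x + y) <= nrm x + nrm y.
Proof. by rewrite -lecR rmorphD/= -!normr_nrm ler_normD. Qed.

Lemma nrm0 : nrm (0 : V) = 0.
Proof. by apply: complexI; rewrite -normr_nrm normr0. Qed.

Lemma nrm0_eq0 x : nrm x = 0 -> x = 0.
Proof. by move=> x0; apply/normr0_eq0; rewrite normr_nrm x0. Qed.

Lemma nrmN x : nrm (- x) = nrm x.
Proof. by rewrite /nrm normrN. Qed.

Lemma nrmB x y : nrm (x - y) = nrm (y - x).
Proof. by rewrite -nrmN opprB. Qed.

End real_norm.

Section real_norm_complex.
Variable R : realType.
Implicit Types (z w : R[i]^o) (r : R).

Lemma nrmZ (V : normedModType R[i]) z (x : V) :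
  nrm (z *: x) = nrm z * nrm x.
Proof. by apply: complexI; rewrite rmorphM/= -!normr_nrm normrZ. Qed.

Lemma nrmM z w : nrm (z * w : R[i]^o) = nrm z * nrm w.
Proof. exact: nrmZ. Qed.

Lemma nrmR r : nrm (r%:C : R[i]^o) = `|r|.
Proof. by rewrite /nrm normc_def /= expr0n addr0 sqrtr_sqr. Qed.

Lemma nrm_sqr z : nrm z ^+ 2 = complex.Re z ^+ 2 + complex.Im z ^+ 2.
Proof.
by apply: complexI; rewrite rmorphXn/= -normr_nrm add_Re2_Im2.
Qed.

Lemma nrm_conjc z : nrm (conjc z : R[i]^o) = nrm z.
Proof. by rewrite /nrm normcJ. Qed.

Lemma mul_conjc z : z * conjc z = (nrm z ^+ 2)%:C.
Proof. by rewrite -sqr_normc rmorphXn/= -normr_nrm. Qed.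

End real_norm_complex.

Section real_norm_topology.
Variables (R : realType) (V : normedModType R[i]).

(** The topology of V is given by balls whose radii are positive elements of
    R[i]; these are exactly the positive reals, so convergence can be tested
    on the real-valued norm. *)
Lemma cvg_nrmP (T : Type) (F : set_system T) (FF : Filter F)
    (u : T -> V) (l : V) :
  (u @ F --> l) <-> (nrm (u t - l) @[t --> F] --> 0).
Proof.
split=> [/cvgrPdist_le ul|/cvgr0Pnorm_le ul].
  apply/cvgr0Pnorm_le => e e0; have := ul e%:C; rewrite ltcR => /(_ e0).
  apply: filterS => t; rewrite normr_nrm lecR ger0_norm ?nrm_ge0//.
  by rewrite nrmB.
apply/cvgrPdist_le => e e0.
have eE : e = (complex.Re e)%:C by rewrite RRe_real// gtr0_real.
have := ul (complex.Re e); rewrite -ltcR -eE => /(_ e0).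
apply: filterS => t; rewrite eE normr_nrm lecR ger0_norm ?nrm_ge0//.
by rewrite nrmB.
Qed.

Lemma bounded_linear_is_continuous (W : normedModType R[i]) (f : V -> W)
    (K : R) :
  linear f -> (forall x, nrm (f x) <= K * nrm x) -> continuous f.
Proof.
move=> lf fK x.
have fB y z : f (y - z) = f y - f z.
  by rewrite addrC -scaleN1r lf scaleN1r addrC.
apply/(@cvgrPdist_lt _ _ _ (nbhs x)) => e e0; near=> y.
rewrite -fB.
have K0 : 0 < `|K| + 1 by rewrite ltr_wpDl.
apply: (@le_lt_trans _ _ ((`|K| + 1)%:C * `|x - y|)).
  rewrite !normr_nrm -rmorphM/= lecR (le_trans (fK _))// ler_wpM2r ?nrm_ge0//.
  by rewrite (le_trans (ler_norm K))// lerDl.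
rewrite -ltr_pdivlMl ?ltcR//.
near: y; apply: cvgr_dist_lt => //.
by rewrite mulr_gt0// invr_gt0 ltcR.
Unshelve. all: by end_near. Qed.

Lemma continuous_linear_nrm_le (W : normedModType R[i]) (f : V -> W) :
  linear f -> continuous f ->
  exists2 K : R, 0 <= K & forall x, nrm (f x) <= K * nrm x.
Proof.
move=> lf cf.
pose g : {linear V -> W} :=
  HB.pack_for {linear V -> W} f (GRing.isLinear.Build _ _ _ _ f lf).
have /linear_bounded_continuous/linear_boundedP : continuous g by [].
move=> /pinfty_ex_gt0[k k0 gk].
have kE : k = (complex.Re k)%:C by rewrite RRe_real// gtr0_real.
exists (complex.Re k).
  by rewrite -lecR -kE ltW.
by move=> x; rewrite -lecR rmorphM/= -kE -!normr_nrm gk.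
Qed.

Lemma opnorm_le (W : normedModType R[i]) (f : V -> W) (K : R) :
  0 <= K -> (forall x, nrm (f x) <= K * nrm x) -> opnorm f <= K.
Proof.
move=> K0 fK; apply: ge_sup.
  by exists (nrm (f 0)), 0 => //=; rewrite nrm0.
move=> _ [x /= x1 <-]; rewrite (le_trans (fK x))//.
by rewrite -[leRHS]mulr1 ler_wpM2l.
Qed.

Lemma nrm_le_opnorm (W : normedModType R[i]) (f : V -> W) (K : R) x :
  (forall x, nrm (f x) <= K * nrm x) -> nrm x <= 1 -> nrm (f x) <= opnorm f.
Proof.
move=> fK x1; apply: ub_le_sup; last by exists x.
exists `|K| => _ [y /= y1 <-]; rewrite (le_trans (fK y))//.
rewrite (le_trans (ler_wpM2r (nrm_ge0 _) (ler_norm K)))//.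
by rewrite -[leRHS]mulr1 ler_wpM2l.
Qed.

Lemma opnorm_ge0 (W : normedModType R[i]) (f : V -> W) (K : R) :
  (forall x, nrm (f x) <= K * nrm x) -> 0 <= opnorm f.
Proof.
move=> fK; apply: (le_trans (nrm_ge0 (f 0))).
by apply: nrm_le_opnorm fK _; rewrite nrm0.
Qed.

End real_norm_topology.

(** * Square-summable complex sequences *)

Section square_sums.
Variable R : realType.
Implicit Types (x y : nat -> R[i]^o) (a b : nat -> R) (k m : nat).

(** Cauchy-Schwarz: the quadratic form in (t, s) given by the sum of the
    squares of t * a i - s * b i is nonnegative. *)
Lemma sqr_sum_mul_le (a b : nat -> R) k m :
  (\sum_(k <= i < m) a i * b i) ^+ 2 <=
  (\sum_(k <= i < m) a i ^+ 2) * (\sum_(k <= i < m) b i ^+ 2).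
Proof.
set A := (\sum_(k <= i < m) a i ^+ 2); set B := (\sum_(k <= i < m) b i ^+ 2).
set P := (\sum_(k <= i < m) a i * b i).
have A0 : 0 <= A by apply: sumr_ge0 => i _; rewrite sqr_ge0.
have quad t s : 0 <= t ^+ 2 * A - 2 * t * s * P + s ^+ 2 * B.
  suff -> : t ^+ 2 * A - 2 * t * s * P + s ^+ 2 * B =
      \sum_(k <= i < m) (t * a i - s * b i) ^+ 2.
    by apply: sumr_ge0 => i _; rewrite sqr_ge0.
  rewrite /A /B /P !mulr_sumr -sumrB -big_split/=.
  by apply: eq_bigr => i _; ring.
have [A_0|An0] := eqVneq A 0.
  have [P0|Pn0] := eqVneq P 0; first by rewrite P0 expr0n/= A_0 mul0r.
  (* With A = 0 the form is B - 2 t P at s = 1; this t makes it equal to - 1. *)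
  have := quad ((B + 1) / (2 * P)) 1.
  have -> : ((B + 1) / (2 * P)) ^+ 2 * A - 2 * ((B + 1) / (2 * P)) * 1 * P
      + 1 ^+ 2 * B = - 1 by rewrite A_0; field.
  by rewrite oppr_ge0 ler10.
have := quad P A.
have -> : P ^+ 2 * A - 2 * P * A * P + A ^+ 2 * B =
    A * (A * B - P ^+ 2).
  by ring.
by rewrite pmulr_rge0 ?lt_neqAle 1?eq_sym ?An0// subr_ge0.
Qed.

Definition sqsum x k : R := \sum_(0 <= i < k) nrm (x i) ^+ 2.

Lemma sqsum_ge0 x k : 0 <= sqsum x k.
Proof. by apply: sumr_ge0 => i _; rewrite sqr_ge0. Qed.

Lemma sqsum_nd x k m : (k <= m)%N -> sqsum x k <= sqsum x m.
Proof.
move=> km; rewrite /sqsum [leRHS](@big_cat_nat _ _ _ k)//= lerDl.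
by apply: sumr_ge0 => i _; rewrite sqr_ge0.
Qed.

Lemma nrm_sum_mul_le x y k :
  nrm (\sum_(0 <= i < k) x i * y i : R[i]^o) <=
  Num.sqrt (sqsum x k) * Num.sqrt (sqsum y k).
Proof.
rewrite -sqrtrM ?sqsum_ge0//.
apply: (@le_trans _ _ (\sum_(0 <= i < k) nrm (x i) * nrm (y i))).
  elim: k => [|k IH]; first by rewrite !big_nil nrm0.
  by rewrite !big_nat_recr//= (le_trans (nrmD _ _))// nrmM lerD.
have S0 : 0 <= \sum_(0 <= i < k) nrm (x i) * nrm (y i).
  by apply: sumr_ge0 => i _; rewrite mulr_ge0 ?nrm_ge0.
rewrite -[leLHS]ger0_norm// -sqrtr_sqr ler_wsqrtr//; exact: sqr_sum_mul_le.
Qed.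

(** Minkowski's inequality, from Cauchy-Schwarz. *)
Lemma sqrt_sqsumD x y k : Num.sqrt (sqsum (x + y) k) <=
  Num.sqrt (sqsum x k) + Num.sqrt (sqsum y k).
Proof.
set r := Num.sqrt _; set s := Num.sqrt _; set t := Num.sqrt _.
have [s0 t0] : 0 <= s /\ 0 <= t by rewrite !sqrtr_ge0.
rewrite -(ger0_norm (addr_ge0 s0 t0)) -sqrtr_sqr ler_wsqrtr//.
have -> : (s + t) ^+ 2 = sqsum x k + (s * t) *+ 2 + sqsum y k.
  by rewrite sqrrD !sqr_sqrtr ?sqsum_ge0.
have h : \sum_(0 <= i < k) nrm (x i) * nrm (y i) <= s * t.
  rewrite -(ger0_norm (mulr_ge0 s0 t0)) -sqrtr_sqr exprMn.
  rewrite !sqr_sqrtr ?sqsum_ge0//.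
  rewrite (le_trans (ler_norm _))// -sqrtr_sqr ler_wsqrtr//.
  exact: sqr_sum_mul_le.
apply: (@le_trans _ _ (sqsum x k +
    (\sum_(0 <= i < k) nrm (x i) * nrm (y i)) *+ 2 + sqsum y k)).
  rewrite -sumrMnl -!big_split/=; apply: ler_sum => i _.
  rewrite -sqrrD lerXn2r ?nnegrE ?addr_ge0 ?nrm_ge0//; exact: nrmD.
by rewrite lerD2r lerD2l lerMn2r h orbT.
Qed.

Lemma sqsumZ (z : R[i]^o) x k :
  sqsum (fun i => z * x i) k = nrm z ^+ 2 * sqsum x k.
Proof.
by rewrite /sqsum mulr_sumr; apply: eq_bigr => i _; rewrite nrmM exprMn.
Qed.

Lemma le_sqsum x y k : (forall i, (i < k)%N -> nrm (x i) <= nrm (y i)) ->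
  sqsum x k <= sqsum y k.
Proof.
move=> xy; rewrite /sqsum !big_mkord; apply: ler_sum => i _.
by rewrite lerXn2r ?nnegrE ?nrm_ge0 ?xy.
Qed.

Definition square_summable : {pred nat -> R[i]^o} :=
  fun x => `[< exists c, forall k, sqsum x k <= c >].

Lemma square_summableP x :
  reflect (exists c, forall k, sqsum x k <= c) (x \in square_summable).
Proof. exact: asboolP. Qed.

Lemma square_summable_submod : submod_closed square_summable.
Proof.
split=> [|z x y].
  apply/square_summableP; exists 0 => k.
  by rewrite /sqsum big1// => i _; rewrite nrm0 expr0n.
move=> /square_summableP[c xc] /square_summableP[d yd].
apply/square_summableP.
exists ((Num.sqrt (nrm (z : R[i]^o) ^+ 2 * c) + Num.sqrt d) ^+ 2) => k.
rewrite -ler_sqrt ?sqr_ge0// sqrtr_sqr ger0_norm ?addr_ge0 ?sqrtr_ge0//.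
rewrite (le_trans (sqrt_sqsumD _ _ _))// lerD ?ler_wsqrtr//.
by rewrite (_ : z *: x = fun i => z * x i)// sqsumZ ler_wpM2l ?sqr_ge0.
Qed.

HB.instance Definition _ := GRing.isSubmodClosed.Build _ _ square_summable
  square_summable_submod.

Lemma square_summable_le x y (c : R) : (forall i, nrm (x i) <= c * nrm (y i)) ->
  y \in square_summable -> x \in square_summable.
Proof.
move=> xy /square_summableP[d yd]; apply/square_summableP.
exists (nrm (c%:C : R[i]^o) ^+ 2 * d) => k.
rewrite (@le_trans _ _ (sqsum (fun i => (c%:C : R[i]^o) * y i) k))//.
  apply: le_sqsum => i _; rewrite nrmM nrmR (le_trans (xy i))//.
  by rewrite ler_wpM2r ?nrm_ge0 ?ler_norm.
by rewrite sqsumZ ler_wpM2l ?sqr_ge0.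
Qed.

Record ell2 := Ell2 { coord : nat -> R[i]^o; _ : coord \in square_summable }.

HB.instance Definition _ := [isSub for coord].
HB.instance Definition _ := [Choice of ell2 by <:].
HB.instance Definition _ := [SubChoice_isSubLmodule of ell2 by <:].

Coercion coord : ell2 >-> Funclass.
Implicit Types (u v : ell2).

Lemma ell2_summable u : coord u \in square_summable.
Proof. exact: valP. Qed.

Lemma ell2P u v : u =1 v -> u = v.
Proof. by move=> uv; apply/val_inj/funext. Qed.

Lemma coordD u v i : (u + v) i = u i + v i.
Proof. by []. Qed.

Lemma coordB u v i : (u - v) i = u i - v i.
Proof. by []. Qed.

Lemma coordZ (z : R[i]) u i : (z *: u) i = z * u i.
Proof. by []. Qed.

Lemma coord0 i : (0 : ell2) i = 0.
Proof. by []. Qed.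

Definition ell2_norm u : R := Num.sqrt (sup (range (sqsum u))).

Let sqsum_has_sup u : has_sup (range (sqsum u)).
Proof.
split; first by exists (sqsum u 0%N), 0%N.
have /square_summableP[c uc] := ell2_summable u.
by exists c => _ [k _ <-].
Qed.

Let sup_sqsum_ge0 u : 0 <= sup (range (sqsum u)).
Proof.
apply: (@le_trans _ _ (sqsum u 0)); first exact: sqsum_ge0.
by apply: sup_upper_bound => //; exists 0%N.
Qed.

Lemma sqrt_sqsum_le_norm u k : Num.sqrt (sqsum u k) <= ell2_norm u.
Proof. by rewrite ler_wsqrtr//; apply: sup_upper_bound => //; exists k. Qed.

Lemma ell2_norm_le u (c : R) :
  0 <= c -> (forall k, sqsum u k <= c ^+ 2) -> ell2_norm u <= c.
Proof.
move=> c0 uc; rewrite -(ger0_norm c0) -sqrtr_sqr ler_wsqrtr//.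
by apply: ge_sup; [exists (sqsum u 0%N), 0%N|move=> _ [k _ <-]].
Qed.

Lemma ell2_norm_ge0 u : 0 <= ell2_norm u.
Proof. exact: sqrtr_ge0. Qed.

Lemma sqsum_le_norm u k : sqsum u k <= ell2_norm u ^+ 2.
Proof. by rewrite sqr_sqrtr//; apply: sup_upper_bound => //; exists k. Qed.

(** The tails of the series of squares are uniformly small: k is chosen such
    that the k-th partial sum is within e of the supremum. *)
Lemma sqsum_tail u (e : R) : 0 < e -> exists k, forall m,
  sqsum u m <= sqsum u k + e.
Proof.
move=> e0; have [_ [k _ <-] uk] := sup_adherent e0 (sqsum_has_sup u).
exists k => m; rewrite -lerBlDr (le_trans _ (ltW uk))// lerD2r.
by apply: sup_upper_bound => //; exists m.
Qed.

Lemma ell2_normD u v : ell2_norm (u + v) <= ell2_norm u + ell2_norm v.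
Proof.
apply: ell2_norm_le; first by rewrite addr_ge0 ?ell2_norm_ge0.
move=> k; rewrite -ler_sqrt ?sqr_ge0// sqrtr_sqr.
rewrite ger0_norm ?addr_ge0 ?ell2_norm_ge0//.
by rewrite (le_trans (sqrt_sqsumD _ _ _))// lerD ?sqrt_sqsum_le_norm.
Qed.

Lemma ell2_norm_eq0 u : ell2_norm u = 0 -> u = 0.
Proof.
move=> u0; apply: ell2P => i; apply: nrm0_eq0.
have := sqsum_le_norm u i.+1; rewrite u0 expr0n/= /sqsum big_nat_recr//=.
move=> h; apply/eqP; rewrite -sqrf_eq0 eq_le sqr_ge0 andbT (le_trans _ h)//.
by rewrite lerDr sqsum_ge0.
Qed.

Let ell2_normZ_le (z : R[i]^o) u : ell2_norm (z *: u) <= nrm z * ell2_norm u.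
Proof.
apply: ell2_norm_le; first by rewrite mulr_ge0 ?ell2_norm_ge0 ?nrm_ge0.
move=> k; rewrite (_ : coord (z *: u) = fun i => z * u i)// sqsumZ exprMn.
by rewrite ler_wpM2l ?sqr_ge0 ?sqsum_le_norm.
Qed.

Lemma ell2_normZ (z : R[i]^o) u : ell2_norm (z *: u) = nrm z * ell2_norm u.
Proof.
apply/eqP; rewrite eq_le ell2_normZ_le/=.
have [->|z0] := eqVneq z 0.
  by rewrite nrm0 mul0r ell2_norm_ge0.
rewrite -{1}(scale1r u) -(mulVf z0) -scalerA.
have nz : nrm z != 0 by apply: contra_neq z0 => /nrm0_eq0.
rewrite (le_trans (ler_wpM2l (nrm_ge0 _) (ell2_normZ_le _ _)))//.
by rewrite mulrA -nrmM divff// (nrmR 1) normr1 mul1r.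
Qed.

End square_sums.

(** * The Banach space of square-summable sequences *)

Lemma cvg_sum_nat (R : realType) (T : Type) (F : set_system T) (FF : Filter F)
    (f : T -> nat -> R) (l : nat -> R) k :
  (forall i, f t i @[t --> F] --> l i) ->
  (\sum_(0 <= i < k) f t i) @[t --> F] --> \sum_(0 <= i < k) l i.
Proof.
move=> fl; elim: k => [|k IH].
  by under eq_cvg do rewrite big_nil; rewrite big_nil; exact: cvg_cst.
under eq_cvg do rewrite big_nat_recr//=; rewrite big_nat_recr//=.
exact: cvgD.
Qed.

Section ell2_space.
Variable R : realType.
Implicit Types (u v : ell2 R) (k m : nat).

Let ell2_normC_D u v :
  (ell2_norm (u + v))%:C <= (ell2_norm u)%:C + (ell2_norm v)%:C.
Proof. by rewrite -rmorphD/= lecR ell2_normD. Qed.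

Let ell2_normC_Z (z : R[i]) u :
  (ell2_norm (z *: u))%:C = `|z| * (ell2_norm u)%:C.
Proof. by rewrite ell2_normZ rmorphM/= (normr_nrm (z : R[i]^o)). Qed.

Let ell2_normC_eq0 u : (ell2_norm u)%:C = 0 -> u = 0.
Proof. by move=> [] /ell2_norm_eq0. Qed.

HB.instance Definition _ := Lmodule_isNormed.Build R[i] (ell2 R)
  ell2_normC_D ell2_normC_Z ell2_normC_eq0.

Lemma nrm_ell2 u : nrm u = ell2_norm u.
Proof. by []. Qed.

Lemma nrm_coord u i : nrm (u i) <= nrm u.
Proof.
apply: (le_trans _ (sqrt_sqsum_le_norm u i.+1)).
rewrite -[leLHS]ger0_norm ?nrm_ge0// -sqrtr_sqr ler_wsqrtr//.
by rewrite /sqsum big_nat_recr//= lerDr sqsum_ge0.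
Qed.

(** A Cauchy filter converges coordinatewise, the real and imaginary parts
    being Cauchy in R.  For fixed k the k-th partial sum of squares depends on
    finitely many coordinates, so the Cauchy estimate passes to the limit with
    a bound independent of k; this gives at once that the limit is square
    summable and that the convergence holds in norm. *)
Lemma ell2_cauchy_cvg (F : set_system (ell2 R)) :
  ProperFilter F -> cauchy F -> cvg F.
Proof.
move=> FF /cauchyP Fc.
have {}Fc (e : R) : 0 < e -> exists u, \forall v \near F, nrm (u - v) < e.
  move=> e0; have [|u Fu] := Fc e%:C; first by rewrite ltcR.
  exists u; apply: filterS Fu => v.
  by rewrite -ball_normE/= normr_nrm ltcR.
have part_cvg (p : R[i]^o -> R) : (forall z w, p (z - w) = p z - p w) ->
    (forall z, `|p z| <= nrm z) ->
    forall i, cvg ((fun v : ell2 R => p (v i)) @ F).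
  move=> pB p_le i; apply/cauchy_cvgP/cauchy_exP => e e0.
  have [u Fu] := Fc e e0.
  exists (p (u i)); apply: filterS Fu => v uv.
  rewrite -ball_normE/= -pB.
  by rewrite (le_lt_trans (p_le _))// (le_lt_trans (nrm_coord (u - v) i)).
have nrm_sqrtr (z : R[i]^o) : nrm z =
    Num.sqrt (complex.Re z ^+ 2 + complex.Im z ^+ 2) :> R.
  by rewrite -nrm_sqr sqrtr_sqr ger0_norm ?nrm_ge0.
have re_cvg := part_cvg (@complex.Re R) _ _.
have {}re_cvg i : cvg ((fun v : ell2 R => complex.Re (v i)) @ F).
  apply: re_cvg => [[? ?] [? ?]//|z].
  by rewrite nrm_sqrtr -sqrtr_sqr ler_wsqrtr// lerDl sqr_ge0.
have im_cvg := part_cvg (@complex.Im R) _ _.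
have {}im_cvg i : cvg ((fun v : ell2 R => complex.Im (v i)) @ F).
  apply: im_cvg => [[? ?] [? ?]//|z].
  by rewrite nrm_sqrtr -sqrtr_sqr ler_wsqrtr// lerDr sqr_ge0.
pose y i : R[i]^o :=
  lim ((fun v : ell2 R => complex.Re (v i)) @ F) +i*
  lim ((fun v : ell2 R => complex.Im (v i)) @ F).
have sq_cvg u k : (fun v : ell2 R => sqsum (coord u \- coord v) k) @ F -->
    sqsum (coord u \- y) k.
  apply: cvg_sum_nat => i.
  have sqB (z w : R[i]^o) : nrm (z - w) ^+ 2 =
      (complex.Re z - complex.Re w) ^+ 2 + (complex.Im z - complex.Im w) ^+ 2.
    by rewrite nrm_sqr; case: z w => [? ?] [].
  rewrite (_ : (fun _ => _) = fun v : ell2 R =>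
      (complex.Re (u i) - complex.Re (v i)) ^+ 2 +
      (complex.Im (u i) - complex.Im (v i)) ^+ 2); last first.
    by apply/funext => v; exact: sqB.
  rewrite sqB; apply: cvgD; rewrite !expr2.
    by apply: cvgM; (apply: cvgB; [exact: cvg_cst|exact: re_cvg]).
  by apply: cvgM; (apply: cvgB; [exact: cvg_cst|exact: im_cvg]).
have near_y (e : R) : 0 < e ->
    \forall u \near F, forall k, sqsum (coord u \- y) k <= e ^+ 2.
  move=> e0; have [u0 Fu0] := Fc (e / 2) (divr_gt0 e0 (ltr0Sn _ 1)).
  near=> u => k; apply: (cvgr_to_le (sq_cvg u k)).
  near=> v; rewrite (le_trans (sqsum_le_norm (u - v) k))//.
  rewrite lerXn2r ?nnegrE ?ell2_norm_ge0 ?(ltW e0)// -nrm_ell2.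
  have -> : u - v = (u0 - v) - (u0 - u).
    by rewrite opprB [RHS]addrC addrA subrK.
  rewrite (le_trans (nrmD _ _))// nrmN [leRHS]splitr lerD//.
    by apply: ltW; near: v.
  by apply: ltW; near: u.
have [u1 Fu1] := filter_ex (near_y 1 ltr01).
(* The limit is y = u1 - (u1 - y), a difference of square-summable terms. *)
have ys : y \in @square_summable R.
  rewrite (_ : y = coord u1 - (coord u1 \- y)).
    apply: rpredB; first exact: ell2_summable.
    by apply/square_summableP; exists (1 ^+ 2).
  apply/funext => i; rewrite -[LHS](subKr (u1 i)); reflexivity.
apply/cvg_ex; exists (Ell2 ys).
apply/cvg_nrmP; apply/cvgr0Pnorm_le => e e0.
apply: filterS (near_y e e0) => u uy.
rewrite ger0_norm ?nrm_ge0// nrm_ell2; apply: ell2_norm_le; first exact: ltW.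
exact: uy.
Unshelve. all: by end_near. Qed.

HB.instance Definition _ := Uniform_isComplete.Build (ell2 R) ell2_cauchy_cvg.

End ell2_space.

(** * Dominated convergence and truncations *)

Section ell2_cvg.
Variable R : realType.
Implicit Types (u v : ell2 R) (x : nat -> R[i]^o) (i k m n : nat).

(** Dominated convergence: beyond an index k the sums of squares of w t are
    controlled by the tail of u, uniformly in t, and the first k coordinates
    tend to 0 together. *)
Lemma ell2_dominated_cvg0 (T : Type) (F : set_system T) (FF : Filter F)
    (w : T -> ell2 R) u :
  (\forall t \near F, forall i, nrm (w t i) <= nrm (u i)) ->
  (forall i, nrm (w t i) @[t --> F] --> 0) ->
  nrm (w t) @[t --> F] --> 0.
Proof.
move=> wu w0; apply/cvgr0Pnorm_le => e e0.
have e20 : 0 < e ^+ 2 / 2 by rewrite divr_gt0 ?exprn_gt0.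
have [k uk] := sqsum_tail u e20.
have wk0 : sqsum (w t) k @[t --> F] --> 0.
  rewrite (_ : 0 = \sum_(0 <= i < k) (0 : R)); last by rewrite big1.
  apply: cvg_sum_nat => i.
  rewrite -[X in _ --> X](mulr0 0); under eq_cvg do rewrite expr2.
  exact: cvgM.
move/cvgr_le : wk0 => /(_ _ e20) wk0.
near=> t.
have wtu : forall i, nrm (w t i) <= nrm (u i) by near: t.
have wtk : sqsum (w t) k <= e ^+ 2 / 2.
  by near: t.
rewrite ger0_norm ?nrm_ge0// nrm_ell2; apply: ell2_norm_le; first exact: ltW.
move=> m; rewrite [leRHS]splitr.
have [mk|/ltnW km] := leqP m k.
  by rewrite (le_trans (sqsum_nd _ mk))// (le_trans wtk)// lerDl ltW.
rewrite {1}/sqsum (@big_cat_nat _ _ _ k)//= lerD//.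
have := uk m; rewrite {1}/sqsum (@big_cat_nat _ _ _ k)//= lerD2l.
apply: le_trans; apply: ler_sum => i _.
by rewrite lerXn2r ?nnegrE ?nrm_ge0 ?wtu.
Unshelve. all: by end_near. Qed.

Let trunc_seq k x i := if (i < k)%N then x i else 0.

Let sqsum_trunc_seq k x m : sqsum (trunc_seq k x) m <= sqsum x k.
Proof.
have -> : sqsum (trunc_seq k x) m = sqsum x (minn k m).
  elim: m => [|m IH]; first by rewrite minn0 /sqsum !big_nil.
  rewrite /sqsum big_nat_recr//= -/(sqsum _ _) IH /trunc_seq.
  case: (boolP (m < k)%N) => [mk|]; last rewrite -leqNgt => km.
    by rewrite (minn_idPr mk) (minn_idPr (ltnW mk)) [RHS]big_nat_recr.
  by rewrite nrm0 expr0n/= addr0 (minn_idPl km) (minn_idPl (leqW km)).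
by rewrite sqsum_nd// geq_minl.
Qed.

Let trunc_seq_summable k x : trunc_seq k x \in @square_summable R.
Proof. by apply/square_summableP; exists (sqsum x k) => m. Qed.

Definition trunc k x : ell2 R := Ell2 (trunc_seq_summable k x).

Definition basis n : ell2 R := trunc n.+1 (fun i => (i == n)%:R).

Lemma truncE k x i : trunc k x i = if (i < k)%N then x i else 0.
Proof. by []. Qed.

Lemma basisE n i : basis n i = (i == n)%:R.
Proof.
by rewrite truncE ltnS; case: eqVneq => [->|]; rewrite ?leqnn ?if_same.
Qed.

Lemma nrm_trunc_le k x : nrm (trunc k x) <= Num.sqrt (sqsum x k).
Proof.
rewrite nrm_ell2; apply: ell2_norm_le; first exact: sqrtr_ge0.
by move=> m; rewrite sqr_sqrtr ?sqsum_ge0 ?sqsum_trunc_seq.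
Qed.

Lemma nrm_basis n : nrm (basis n) = 1.
Proof.
have n1 b : nrm (b%:R : R[i]^o) = b%:R :> R.
  by rewrite -(rmorph_nat (real_complex R)) nrmR normr_nat.
apply/eqP; rewrite eq_le; apply/andP; split; last first.
  by rewrite (le_trans _ (nrm_coord _ n))// basisE eqxx n1.
rewrite (le_trans (nrm_trunc_le _ _))// /sqsum big_nat_recr//= eqxx n1.
rewrite big_nat big1 ?add0r ?expr1n ?sqrtr1// => i /andP[_ i_n].
by rewrite (ltn_eqF i_n) n1 expr0n.
Qed.

Lemma trunc_sum k x : trunc k x = \sum_(0 <= i < k) x i *: basis i.
Proof.
elim: k => [|k IH]; first by rewrite big_nil; apply: ell2P.
rewrite big_nat_recr//= -IH; apply: ell2P => i.
rewrite coordD coordZ basisE !truncE ltnS leq_eqVlt.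
by case: ltngtP => /= [_|_|->]; rewrite ?mulr0 ?mulr1 ?addr0 ?add0r.
Qed.

Lemma trunc_cvg u : trunc k u @[k --> \oo] --> u.
Proof.
apply/cvg_nrmP; apply: (@ell2_dominated_cvg0 _ _ _ _ u).
  near=> k => i; rewrite coordB truncE.
  by case: ifP => _; rewrite ?subrr ?nrm0 ?nrm_ge0// sub0r nrmN.
move=> i; apply: (cvg_near_cst 0); near=> k.
rewrite coordB truncE ifT ?subrr ?nrm0//.
by near: k; exact: nbhs_infty_gt.
Unshelve. all: by end_near. Qed.

End ell2_cvg.

(** * Reflexivity *)

Lemma le_sqr_of_le_mul_sqrt (R : realType) (K s : R) :
  0 <= K -> 0 <= s -> s <= K * Num.sqrt s -> s <= K ^+ 2.
Proof.
move=> K0 s0; rewrite -{1 3}(sqr_sqrtr s0).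
have [->|r0] := eqVneq (Num.sqrt s) 0; first by rewrite expr0n/= sqr_ge0.
rewrite expr2 ler_pM2r ?lt_neqAle 1?eq_sym ?r0 ?sqrtr_ge0// => rK.
by rewrite -expr2 lerXn2r ?nnegrE ?sqrtr_ge0.
Qed.

Section ell2_reflexive.
Variable R : realType.
Implicit Types (u v : ell2 R) (x c : nat -> R[i]^o) (f g : ell2 R -> R[i]^o).

Lemma topological_dualP f :
  topological_dual f <->
  linear f /\ exists K : R, forall u, nrm (f u) <= K * nrm u.
Proof.
split=> [[lf cf]|[lf [K fK]]]; split => //.
  by have [K _ fK] := continuous_linear_nrm_le lf cf; exists K.
exact: bounded_linear_is_continuous fK.
Qed.

Lemma linear_trunc f k x : linear f ->
  f (trunc k x) = \sum_(0 <= i < k) f (basis R i) * x i.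
Proof.
move=> lf.
have f0 : f 0 = 0.
  by have := lf (-1) 0 0; rewrite scaleN1r oppr0 add0r scaleN1r addNr.
rewrite trunc_sum; elim: k => [|k IH]; first by rewrite !big_nil.
by rewrite !big_nat_recr//= addrC lf IH addrC mulrC.
Qed.

(** Test f on the truncations of the conjugate of its own coefficient
    sequence c: the value is the partial sum s of the squares of c, while
    continuity bounds it by K times the square root of s. *)
Lemma dual_coef_summable f : topological_dual f ->
  (fun i => f (basis R i)) \in @square_summable R.
Proof.
case=> lf cf; have [K K0 fK] := continuous_linear_nrm_le lf cf.
set c := fun i => f (basis R i).
apply/square_summableP; exists (K ^+ 2) => k.
pose cc i : R[i]^o := conjc (c i).
have ccE : sqsum cc k = sqsum c k.
  by apply: eq_bigr => i _; rewrite nrm_conjc.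
have fE : f (trunc k cc) = (sqsum c k)%:C.
  rewrite linear_trunc// rmorph_sum/=; apply: eq_bigr => i _.
  exact: mul_conjc.
have := fK (trunc k cc); rewrite fE nrmR ger0_norm ?sqsum_ge0// => h.
have {}h := le_trans h (ler_wpM2l K0 (nrm_trunc_le _ _)).
by apply: le_sqr_of_le_mul_sqrt; rewrite ?sqsum_ge0 -?{2}ccE.
Qed.

(** On truncations f is the pairing with v, where Cauchy-Schwarz applies;
    the estimate extends to all u since truncations converge.  Applied to
    differences of forms, it turns convergence of coefficient sequences in
    l^2 into convergence of forms in the dual norm. *)
Lemma dual_nrm_le f v : topological_dual f ->
  (forall i, f (basis R i) = v i) -> forall u, nrm (f u) <= nrm v * nrm u.
Proof.
move=> [lf cf] fv u; apply/ler_addgt0Pr => e e0.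
have : f (trunc k u) @[k --> \oo] --> f u.
  exact: (cvg_comp _ _ (@trunc_cvg R u) (cf u)).
move=> /cvg_nrmP/cvgr0Pnorm_le/(_ e e0)[k _ /(_ k (leqnn k))] /=.
rewrite ger0_norm ?nrm_ge0// => h.
rewrite -(subrK (f (trunc k u)) (f u)) addrC (le_trans (nrmD _ _))// lerD//.
  rewrite linear_trunc//; under eq_bigr do rewrite fv.
  rewrite (le_trans (nrm_sum_mul_le _ _ _))//.
  by rewrite ler_pM ?sqrtr_ge0 ?sqrt_sqsum_le_norm.
by rewrite nrmB.
Qed.

Definition coord_form c k : ell2 R -> R[i]^o :=
  fun u => \sum_(0 <= i < k) c i * u i.

Lemma coord_form_dual c k : topological_dual (coord_form c k).
Proof.
apply/topological_dualP; split.
  move=> a u v; rewrite /coord_form scaler_sumr -big_split/=.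
  apply: eq_bigr => i _; transitivity (c i * (a * u i + v i)) => //.
  by rewrite mulrDr mulrCA.
exists (Num.sqrt (sqsum c k)) => u.
rewrite (le_trans (nrm_sum_mul_le _ _ _))// ler_wpM2l ?sqrtr_ge0//.
exact: sqrt_sqsum_le_norm.
Qed.

Lemma coord_form_basis c k j :
  coord_form c k (basis R j) = if (j < k)%N then c j else 0.
Proof.
rewrite /coord_form; under eq_bigr do rewrite basisE.
elim: k => [|k IH]; first by rewrite big_nil.
rewrite big_nat_recr//= IH ltnS [(j <= k)%N]leq_eqVlt.
by case: ltngtP => /= [_|_|->]; rewrite ?mulr0 ?mulr1 ?addr0 ?add0r.
Qed.

Lemma dual_scaleD (a : R[i]) f g : topological_dual f -> topological_dual g ->
  topological_dual (fun u => a *: f u + g u).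
Proof.
move=> /topological_dualP[lf [K fK]] /topological_dualP[lg [L gL]].
apply/topological_dualP; split.
  by move=> b u v; rewrite lf lg !scalerDr addrACA !scalerA mulrC.
exists (nrm (a : R[i]^o) * K + L) => u.
rewrite (le_trans (nrmD _ _))// nrmZ mulrDl lerD// -mulrA.
by rewrite ler_wpM2l ?nrm_ge0.
Qed.

(** The representing vector is x i = phi (delta i), delta i being the i-th
    coordinate functional.  Testing phi on the form with coefficients the
    conjugates of x 0, ..., x k.-1 shows that x is square summable; for any
    form f with coefficients c, the values f (trunc k x) = phi (coord_form c k)
    converge to f x by continuity of f and to phi f by boundedness of phi. *)
Lemma ell2_reflexive : reflexive_space (ell2 R).
Proof.
move=> phi phiD [M phiM].
pose delta i : ell2 R -> R[i]^o := fun u => u i.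
have delta_dual i : topological_dual (delta i).
  apply/topological_dualP; split => //; exists 1 => u.
  by rewrite mul1r nrm_coord.
have phi0 : phi (fun=> 0) = 0.
  have d0 : topological_dual (fun _ : ell2 R => 0 : R[i]^o).
    apply/topological_dualP; split.
      by move=> a u v; rewrite scaler0 addr0.
    by exists 0 => u; rewrite nrm0 mul0r.
  have := phiD (-1) _ _ d0 d0.
  rewrite (_ : (fun _ => _) = fun=> 0); last first.
    by apply/funext => u; rewrite scaler0 addr0.
  by rewrite scaleN1r addNr.
pose x i := phi (delta i).
have phi_form c k : phi (coord_form c k) = \sum_(0 <= i < k) c i * x i.
  elim: k => [|k IH].
    rewrite big_nil -phi0; congr phi; apply/funext => u.
    by rewrite /coord_form big_nil.
  rewrite big_nat_recr//= addrC -IH.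
  rewrite -[c k * x k]/(c k *: x k) -phiD//; last exact: coord_form_dual.
  congr phi; apply/funext => u.
  by rewrite /coord_form big_nat_recr//= addrC.
have xs : x \in @square_summable R.
  apply/square_summableP; exists (`|M| ^+ 2) => k.
  pose cx i : R[i]^o := conjc (x i).
  have cxE : sqsum cx k = sqsum x k.
    by apply: eq_bigr => i _; rewrite nrm_conjc.
  have phiE : phi (coord_form cx k) = (sqsum x k)%:C.
    rewrite phi_form rmorph_sum/=; apply: eq_bigr => i _.
    by rewrite mulrC mul_conjc.
  have := phiM _ (coord_form_dual cx k).
  rewrite phiE nrmR ger0_norm ?sqsum_ge0// => h.
  have {}h : sqsum x k <= `|M| * Num.sqrt (sqsum x k).
    rewrite (le_trans h)// (le_trans (ler_wpM2r _ (ler_norm M)))//.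
      have [_ [K fK]] := (topological_dualP _).1 (coord_form_dual cx k).
      exact: opnorm_ge0 fK.
    rewrite ler_wpM2l//; apply: opnorm_le; first exact: sqrtr_ge0.
    move=> u; rewrite (le_trans (nrm_sum_mul_le _ _ _))// cxE.
    by rewrite ler_wpM2l ?sqrtr_ge0// sqrt_sqsum_le_norm.
  by apply: le_sqr_of_le_mul_sqrt; rewrite ?sqsum_ge0.
exists (Ell2 xs) => f fd.
pose c := Ell2 (dual_coef_summable fd).
have cf := fd.2; have lf := fd.1.
apply: (@cvg_unique _ _ ((fun k => f (trunc k x)) @ \oo)).
- exact: norm_hausdorff.
- apply/cvg_nrmP.
  have c0 : `|M| * nrm (trunc k c - c) @[k --> \oo] --> 0.
    rewrite -[X in _ --> X](mulr0 `|M|); apply: cvgM; first exact: cvg_cst.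
    by apply/cvg_nrmP; exact: trunc_cvg.
  apply: (squeeze_cvgr _ (cvg_cst 0) c0); near=> k.
  rewrite nrm_ge0/=.
  rewrite linear_trunc// -(phi_form c).
  pose g u := (-1) *: coord_form c k u + f u.
  have gd : topological_dual g by exact: dual_scaleD (coord_form_dual c k) fd.
  have gE i : g (basis R i) = (c - trunc k c) i.
    by rewrite /g coord_form_basis scaleN1r addrC coordB truncE.
  have phig : phi g = phi f - phi (coord_form c k).
    rewrite [LHS](phiD (-1) _ _ (coord_form_dual c k) fd) scaleN1r.
    exact: addrC.
  rewrite nrmB -phig.
  rewrite (le_trans (phiM _ gd))// (le_trans (ler_wpM2r _ (ler_norm M)))//.
    have [_ [K fK]] := (topological_dualP _).1 gd.
    exact: opnorm_ge0 fK.
  rewrite ler_wpM2l// nrmB; apply: opnorm_le; first exact: nrm_ge0.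
  exact: dual_nrm_le.
- exact: (cvg_comp _ _ (@trunc_cvg R (Ell2 xs)) (cf (Ell2 xs))).
Unshelve. all: by end_near. Qed.

End ell2_reflexive.

(** * Diagonal operators *)

Section diagonal_operators.
Variable R : realType.
Implicit Types (u v : ell2 R) (d m : nat -> R) (i n : nat) (t s : R).

Lemma nrm_le_coord u v (c : R) : 0 <= c ->
  (forall i, nrm (u i) <= c * nrm (v i)) -> nrm u <= c * nrm v.
Proof.
move=> c0 uv; rewrite nrm_ell2; apply: ell2_norm_le.
  by rewrite mulr_ge0 ?nrm_ge0.
move=> k; rewrite exprMn.
apply: (@le_trans _ _ (sqsum (fun i => (c%:C : R[i]^o) * v i) k)).
  by apply: le_sqsum => i _; rewrite nrmM nrmR ger0_norm.
by rewrite sqsumZ nrmR ger0_norm// ler_wpM2l ?sqr_ge0 ?sqsum_le_norm.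
Qed.

Definition diag_seq d u : nat -> R[i]^o := fun i => (d i)%:C * u i.

Definition diag_dom d : set (ell2 R) :=
  [set u | diag_seq d u \in @square_summable R].

(** Outside diag_dom d, where the product sequence is not square summable,
    the value is the default 0. *)
Definition diag d u : ell2 R := insubd 0 (diag_seq d u).

Definition diag_op d : operator (ell2 R) := Operator (diag_dom d) (diag d).

Lemma diagE d u i : diag_dom d u -> diag d u i = (d i)%:C * u i.
Proof. by move=> du; rewrite /diag -[coord _]/(val _) insubdK. Qed.

Lemma nrm_diag_coord d u i : diag_dom d u ->
  nrm (diag d u i) = `|d i| * nrm (u i).
Proof. by move=> du; rewrite diagE// nrmM nrmR. Qed.

Lemma diag_dom_le d e (c : R) : (forall i, `|d i| <= c * `|e i|) ->
  diag_dom e `<=` diag_dom d.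
Proof.
move=> de u; apply: (@square_summable_le _ _ _ c) => i.
by rewrite !nrmM !nrmR mulrA ler_wpM2r ?nrm_ge0.
Qed.

Lemma diag_dom1 : diag_dom (fun=> 1) = setT.
Proof.
apply/seteqP; split => // u _; rewrite /diag_dom/= /diag_seq.
rewrite (_ : (fun _ => _) = coord u); first exact: ell2_summable.
by apply/funext => i; rewrite mul1r.
Qed.

Lemma bounded_diag_dom d (c : R) u : (forall i, `|d i| <= c) -> diag_dom d u.
Proof.
move=> dc; apply: (@diag_dom_le _ (fun=> 1) c); last by rewrite diag_dom1.
by move=> i; rewrite normr1 mulr1.
Qed.

Lemma nrm_diag_le d e (c : R) u : 0 <= c -> (forall i, `|d i| <= c * `|e i|) ->
  diag_dom e u -> nrm (diag d u) <= c * nrm (diag e u).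
Proof.
move=> c0 de eu; have du := diag_dom_le de eu.
apply: nrm_le_coord => // i.
by rewrite !nrm_diag_coord// mulrA ler_wpM2r ?nrm_ge0.
Qed.

Lemma nrm_bounded_diag_le d (c : R) u : 0 <= c -> (forall i, `|d i| <= c) ->
  nrm (diag d u) <= c * nrm u.
Proof.
move=> c0 dc; apply: nrm_le_coord => // i.
by rewrite nrm_diag_coord ?ler_wpM2r ?nrm_ge0//; exact: bounded_diag_dom dc.
Qed.

Lemma diag_seq_basis d n :
  diag_seq d (basis R n) = coord ((d n)%:C *: basis R n).
Proof.
apply/funext => i; rewrite coordZ /diag_seq basisE.
by case: eqVneq => [->|]; rewrite ?mulr0.
Qed.

Lemma diag_basis_dom d n : diag_dom d (basis R n).
Proof. by rewrite /diag_dom/= diag_seq_basis ell2_summable. Qed.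

Lemma diag_basis d n : diag d (basis R n) = (d n)%:C *: basis R n.
Proof.
apply: ell2P => i; rewrite diagE; last exact: diag_basis_dom.
exact: (congr1 (fun w => w i) (diag_seq_basis d n)).
Qed.

Lemma diag_linear d (a : R[i]) u v : diag_dom d u -> diag_dom d v ->
  diag_dom d (a *: u + v) /\ diag d (a *: u + v) = a *: diag d u + diag d v.
Proof.
move=> du dv.
have E : diag_seq d (a *: u + v) = coord (a *: diag d u + diag d v).
  apply/funext => i; rewrite coordD coordZ !diagE// /diag_seq coordD coordZ.
  by rewrite mulrDr mulrCA.
have duv : diag_dom d (a *: u + v) by rewrite /diag_dom/= E ell2_summable.
split => //; apply: ell2P => i; rewrite diagE//.
exact: (congr1 (fun w => w i) E).
Qed.

Lemma diag_op_linear d : linear_operator (diag_op d).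
Proof.
split; last by move=> a u v; exact: diag_linear.
rewrite /= /diag_dom/= (_ : diag_seq d _ = coord (0 : ell2 R)).
  exact: ell2_summable.
by apply/funext => i; rewrite /diag_seq coord0 mulr0.
Qed.

(** * Diagonal semigroups *)

Definition diag_semigroup m t : ell2 R -> ell2 R :=
  diag (fun i => expR (- m i * t)).

Lemma cvg_mul_at_right0 (c r : R) : c * t * r @[t --> 0^'+] --> 0.
Proof.
rewrite -[X in _ --> X](mul0r r) -[in X in _ --> X](mulr0 c).
apply: cvgM; last exact: cvg_cst.
by apply: cvgM; [exact: cvg_cst|exact/cvg_at_right_filter/cvg_id].
Qed.

Section contraction.
Variable m : nat -> R.
Hypothesis m0 : forall i, 0 <= m i.

Lemma expRN_le1 s : 0 <= s -> expR (- s) <= 1.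
Proof. by move=> s0; rewrite -expR0 ler_expR oppr_le0. Qed.

Lemma diag_semigroup_symbol_le1 t i : 0 <= t -> `|expR (- m i * t)| <= 1.
Proof.
by move=> t0; rewrite ger0_norm ?expR_ge0// mulNr expRN_le1// mulr_ge0.
Qed.

Lemma diag_semigroupE t u i : 0 <= t ->
  diag_semigroup m t u i = (expR (- m i * t))%:C * u i.
Proof.
move=> t0; rewrite diagE//; apply: (@bounded_diag_dom _ 1) => j.
exact: diag_semigroup_symbol_le1.
Qed.

Lemma diag_semigroup_linear t : 0 <= t -> linear (diag_semigroup m t).
Proof.
move=> t0 a u v; apply: (diag_linear _ _ _).2;
  by apply: (@bounded_diag_dom _ 1) => j; exact: diag_semigroup_symbol_le1.
Qed.

Lemma diag_semigroup_contraction t u : 0 <= t ->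
  nrm (diag_semigroup m t u) <= nrm u.
Proof.
move=> t0; rewrite -[leRHS]mul1r; apply: nrm_bounded_diag_le => // i.
exact: diag_semigroup_symbol_le1.
Qed.

Lemma coord_quotient t u i : 0 < t ->
  ((t^-1)%:C *: (diag_semigroup m t u - u)) i =
  ((expR (- m i * t) - 1) / t)%:C * u i.
Proof.
move=> t0; rewrite coordZ coordB diag_semigroupE ?ltW//.
rewrite -{2}(mul1r (u i)) -mulrBl mulrA; congr (_ * _).
by rewrite mulrC rmorphM rmorphB rmorph1.
Qed.

(** With x = s * t these are 0 <= exp (- x) - 1 + x <= min (x, x ^ 2) divided
    by t; they follow from 1 + x <= exp x and exp (- x) (1 + x) <= 1.  The
    bound by s provides the domination, the bound by s ^ 2 * t the limit. *)
Lemma quotient_symbol_bounds s t : 0 <= s -> 0 < t ->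
  0 <= (expR (- s * t) - 1) / t + s <= s /\
  (expR (- s * t) - 1) / t + s <= s ^+ 2 * t.
Proof.
move=> s0 t0; have st0 : 0 <= s * t by rewrite mulr_ge0// ltW.
have tn0 := lt0r_neq0 t0.
have E : (expR (- s * t) - 1) / t + s = (expR (- s * t) - 1 + s * t) / t.
  by rewrite [RHS]mulrDl mulfK.
have lo := expR_ge1Dx (- s * t).
have hi : expR (- s * t) <= 1 by rewrite mulNr expRN_le1.
have hi2 : expR (- s * t) * (1 + s * t) <= 1.
  rewrite [leRHS](_ : 1 = expR (- s * t) * expR (s * t)).
    by rewrite ler_wpM2l ?expR_ge0// expR_ge1Dx.
  by rewrite -expRD mulNr addNr expR0.
rewrite E; split; first (apply/andP; split).
- by rewrite divr_ge0 ?(ltW t0)//; lra.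
- by rewrite ler_pdivrMr//; lra.
- rewrite ler_pdivrMr//; have := expR_ge0 (- s * t); nra.
Qed.

(** On the domain the difference quotients converge by dominated convergence,
    the dominating vector being the image of u.  Conversely, if they converge
    to v, then v i = - m i * u i for all i by uniqueness of
    coordinatewise limits, so the sequence of products is square summable and
    u is in the domain. *)
Lemma diag_semigroup_generates :
  generates (diag_op (fun i => - m i)) (diag_semigroup m).
Proof.
have quotient_cvg u : diag_dom (fun i => - m i) u ->
    (t^-1)%:C *: (diag_semigroup m t u - u) @[t --> 0^'+] -->
    diag (fun i => - m i) u.
  move=> du; apply/cvg_nrmP.
  have E t i : 0 < t ->
      ((t^-1)%:C *: (diag_semigroup m t u - u) - diag (fun i => - m i) u) i =
      ((expR (- m i * t) - 1) / t + m i)%:C * u i.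
    move=> t0; rewrite coordB coord_quotient// diagE// -mulrBl.
    by rewrite -rmorphB opprK.
  apply: (@ell2_dominated_cvg0 _ _ _ _ _ (diag (fun i => - m i) u)).
    near=> t => i; have t0 : 0 < t by near: t; exact: nbhs_right_gt.
    have [/andP[q0 qm] _] := quotient_symbol_bounds (m0 i) t0.
    rewrite E// nrmM nrmR ger0_norm// nrm_diag_coord// normrN ger0_norm//.
    by rewrite ler_wpM2r ?nrm_ge0.
  move=> i.
  have h0 := cvg_mul_at_right0 (m i ^+ 2) (nrm (u i)).
  apply: (squeeze_cvgr _ (cvg_cst 0) h0); near=> t.
  have t0 : 0 < t by near: t; exact: nbhs_right_gt.
  have [/andP[q0 _] qt] := quotient_symbol_bounds (m0 i) t0.
  by rewrite nrm_ge0 andTb E// nrmM nrmR ger0_norm// ler_wpM2r ?nrm_ge0.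
split; last exact: quotient_cvg.
  split.
  - move=> t t0; have lt := diag_semigroup_linear t0; split => //.
    apply: (bounded_linear_is_continuous (K := 1) lt) => u.
    by rewrite mul1r diag_semigroup_contraction.
  - move=> u; apply: ell2P => i.
    by rewrite diag_semigroupE// mulr0 expR0 mul1r.
  - move=> s t u s0 t0; apply: ell2P => i.
    rewrite !diag_semigroupE ?addr_ge0// mulrA -rmorphM/= -expRD.
    by rewrite mulrDr.
  - move=> u; apply/cvg_nrmP.
    have E t i : 0 <= t -> nrm ((diag_semigroup m t u - u) i) =
        (1 - expR (- m i * t)) * nrm (u i).
      move=> t0; rewrite coordB diag_semigroupE// -{2}(mul1r (u i)) -mulrBl.
      rewrite -(rmorph1 (real_complex R)) -rmorphB nrmM nrmR distrC ger0_norm//.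
      by rewrite subr_ge0 mulNr expRN_le1// mulr_ge0.
    apply: (@ell2_dominated_cvg0 _ _ _ _ _ u).
      near=> t => i; have t0 : 0 < t by near: t; exact: nbhs_right_gt.
      by rewrite E ?(ltW t0)// -[leRHS]mul1r ler_wpM2r ?nrm_ge0.
    move=> i.
    have h0 := cvg_mul_at_right0 (m i) (nrm (u i)).
    apply: (squeeze_cvgr _ (cvg_cst 0) h0); near=> t.
    have t0 : 0 < t by near: t; exact: nbhs_right_gt.
    rewrite nrm_ge0 andTb E ?(ltW t0)// ler_wpM2r ?nrm_ge0//.
    by have := expR_ge1Dx (- m i * t); lra.
apply/seteqP; split => u.
  move=> du; apply/cvg_ex; exists (diag (fun i => - m i) u).
  exact: quotient_cvg.
move=> /cvg_ex[v /cvg_nrmP uv].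
rewrite /= /diag_dom/= (_ : diag_seq _ u = coord v); first exact: ell2_summable.
apply/funext => i.
have cvg_v : (((expR (- m i * t) - 1) / t)%:C * u i : R[i]^o)
    @[t --> 0^'+] --> v i.
  apply/cvg_nrmP; apply: (squeeze_cvgr _ (cvg_cst 0) uv).
  near=> t; have t0 : 0 < t by near: t; exact: nbhs_right_gt.
  by rewrite nrm_ge0 andTb -coord_quotient// -coordB nrm_coord.
apply: (cvg_unique _ _ cvg_v); first exact: norm_hausdorff.
apply/cvg_nrmP.
have h0 := cvg_mul_at_right0 (m i ^+ 2) (nrm (u i)).
apply: (squeeze_cvgr _ (cvg_cst 0) h0); near=> t.
have t0 : 0 < t by near: t; exact: nbhs_right_gt.
have [/andP[q0 _] qt] := quotient_symbol_bounds (m0 i) t0.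
rewrite nrm_ge0 andTb -mulrBl -rmorphB nrmM nrmR opprK ger0_norm//.
by rewrite ler_wpM2r ?nrm_ge0.
Unshelve. all: by end_near. Qed.

Lemma diag_semigroup_exponentially_stable (omega : R) : 0 < omega ->
  (forall i, omega <= m i) -> uniformly_exponentially_stable (diag_semigroup m).
Proof.
move=> omega0 omegam; exists 1, omega; split => // t t0.
rewrite mul1r; apply: opnorm_le; first exact: expR_ge0.
move=> u; apply: nrm_bounded_diag_le; first exact: expR_ge0.
by move=> i; rewrite ger0_norm ?expR_ge0// ler_expR !mulNr lerN2 ler_wpM2r.
Qed.

Lemma diag_semigroup_strongly_stable :
  (forall i, 0 < m i) -> strongly_stable (diag_semigroup m).
Proof.
move=> mpos u; apply: (@ell2_dominated_cvg0 _ _ _ _ _ u).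
  near=> t => i; have t0 : 0 <= t by near: t; exact: nbhs_pinfty_ge.
  rewrite diag_semigroupE// nrmM nrmR -[leRHS]mul1r ler_wpM2r ?nrm_ge0//.
  exact: diag_semigroup_symbol_le1.
move=> i.
have h0 : expR (- (m i * t)) * nrm (u i) @[t --> +oo] --> 0.
  rewrite -[X in _ --> X](mul0r (nrm (u i))).
  apply: cvgM; last exact: cvg_cst.
  apply: (cvg_comp (fun t => m i * t) (fun t => expR (- t))).
    exact: gt0_cvgMry.
  exact: cvgr_expR.
apply: (squeeze_cvgr _ (cvg_cst 0) h0); near=> t.
have t0 : 0 <= t by near: t; exact: nbhs_pinfty_ge.
rewrite nrm_ge0 andTb diag_semigroupE// nrmM nrmR.
by rewrite ger0_norm ?expR_ge0// mulNr.
Unshelve. all: by end_near. Qed.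

(** A basis vector with m i < omega / 2 decays more slowly than
    exp (- omega t): comparing the two gives exp (omega t / 2) <= M for all
    t >= 0, which fails at t = 2 M / omega because exp M > M. *)
Lemma diag_semigroup_not_exponentially_stable :
  (forall e, 0 < e -> exists i, m i < e) ->
  ~ uniformly_exponentially_stable (diag_semigroup m).
Proof.
move=> m_small [M [omega [M1 omega0 TM]]].
have [i mi] := m_small _ (divr_gt0 omega0 (ltr0Sn _ 1)).
have key t : 0 <= t -> expR (omega / 2 * t) <= M.
  move=> t0.
  have h : expR (- m i * t) <= M * expR (- omega * t).
    apply: le_trans (TM t t0).
    have -> : expR (- m i * t) = nrm (diag_semigroup m t (basis R i)).
      rewrite /diag_semigroup diag_basis nrmZ nrmR nrm_basis mulr1.
      by rewrite ger0_norm ?expR_ge0.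
    apply: (nrm_le_opnorm (K := 1)); last by rewrite nrm_basis.
    by move=> u; rewrite mul1r diag_semigroup_contraction.
  rewrite -(ler_pM2r (expR_gt0 (- omega * t))) -expRD.
  apply: le_trans h; rewrite ler_expR -mulrDl ler_wpM2r//.
  by rewrite [X in _ - X]splitr; lra.
have := key (2 * M / omega).
rewrite divr_ge0 ?mulr_ge0 ?(le_trans ler01 M1) ?(ltW omega0)// => /(_ isT).
have -> : omega / 2 * (2 * M / omega) = M by field; rewrite lt0r_neq0.
by have := expR_ge1Dx M; lra.
Qed.

End contraction.
End diagonal_operators.

(** * The perturbed generator *)

Lemma eq_generates (R : realType) (X : normedModType R[i]) (A A' : operator X)
    (T : R -> X -> X) :
  dom A = dom A' -> (forall x, dom A x -> A x = A' x) ->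
  generates A T -> generates A' T.
Proof.
move=> domAA' AA' [T_sg domA A_lim]; split=> [//||x]; rewrite -domAA' //.
by move=> Ax; rewrite -AA'//; exact: A_lim.
Qed.

(** Dividing by the power theta, this says that (n + 1)^(1 - theta) tends to
    infinity. *)
Lemma linear_growth_unbounded (R : realType) (theta c : R) : theta < 1 ->
  exists k, forall n, (k <= n)%N -> c * n.+1%:R `^ theta < n.+1%:R.
Proof.
move=> theta1; pose d := 1 - theta.
have d0 : 0 < d by rewrite subr_gt0.
exists (Num.bound (`|c| `^ d^-1)) => n kn.
have n0 : 0 < n.+1%:R :> R by rewrite ltr0n.
rewrite [ltRHS](_ : _ = n.+1%:R `^ d * n.+1%:R `^ theta); last first.
  by rewrite -powRD ?subrK ?powRr1 ?ler0n// pnatr_eq0 implybT.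
rewrite ltr_pM2r ?powR_gt0// (le_lt_trans (ler_norm c))//.
have -> : `|c| = (`|c| `^ d^-1) `^ d.
  by rewrite -powRrM mulVf ?lt0r_neq0// powRr1.
apply: gt0_ltr_powR => //; rewrite ?nnegrE ?powR_ge0 ?ltW//.
have := archi_boundP (powR_ge0 `|c| d^-1); move/lt_le_trans; apply.
by rewrite ler_nat leqW.
Qed.

Section counterexample.
Variable R : realType.
Implicit Type n : nat.

Let a n : R := if odd n then n.+1%:R else 1.
Let m n : R := if odd n then 2 * n.+1%:R else n.+1%:R^-1.

Let natSr_ge1 n : 1 <= n.+1%:R :> R.
Proof. by rewrite ler1n. Qed.

Let natSVr_gt0 n : 0 < n.+1%:R^-1 :> R.
Proof. by rewrite invr_gt0 ltr0n. Qed.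

Let natSVr_le1 n : n.+1%:R^-1 <= 1 :> R.
Proof. by rewrite invf_le1 ?ltr0n. Qed.

Let a_ge1 n : 1 <= a n.
Proof. by rewrite /a; case: ifP. Qed.

Let m_gt0 n : 0 < m n.
Proof. by rewrite /m; case: ifP => _ //; rewrite mulr_gt0// ltr0n. Qed.

Definition ell2_generator : operator (ell2 R) := diag_op (fun n => - a n).

Local Notation A := ell2_generator.
Let B := Operator (dom A) (diag (fun n => a n - m n)).

Let diff_le n : `|a n - m n| <= 1 * `|- a n|.
Proof.
rewrite mul1r normrN [leRHS]ger0_norm ?(le_trans ler01)// ler_norml /a /m.
have := natSr_ge1 n; have := natSVr_gt0 n; have := natSVr_le1 n.
by move: (n.+1%:R^-1 : R) (n.+1%:R : R) => y x; case: ifP => _ ? ? ?; lra.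
Qed.

(** The bounds m n <= 2 * a n and a n - 1 <= m n give the two inclusions; the
    bounded part 1 of a n is split off because m n can be arbitrarily small. *)
Let dom_eq : diag_dom (fun n => - a n) = diag_dom (fun n => - m n).
Proof.
apply/seteqP; split.
  apply: (@diag_dom_le _ _ _ 2) => n; rewrite !normrN.
  rewrite !ger0_norm ?(ltW (m_gt0 n)) ?(le_trans ler01)//.
  have := natSr_ge1 n; have := natSVr_le1 n.
  rewrite /a /m; move: (n.+1%:R^-1 : R) (n.+1%:R : R) => y x.
  by case: ifP => _ ? ?; lra.
move=> u mu; rewrite /diag_dom/=.
have -> : diag_seq (fun n => - a n) u =
   diag_seq (fun n => - (a n - 1)) u - coord u.
  apply/funext => n; transitivity ((- (a n - 1))%:C * u n - u n) => //.
  rewrite -{2}(mul1r (u n)) -mulrBl -(rmorph1 (real_complex R)) -rmorphB.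
  by rewrite opprB addrAC subrr sub0r.
apply: rpredB; last exact: ell2_summable.
apply: (@diag_dom_le _ _ _ 1 _ _ mu) => n.
rewrite mul1r !normrN !ger0_norm ?subr_ge0 ?(ltW (m_gt0 n))//.
have := natSr_ge1 n; have := natSVr_gt0 n.
rewrite /a /m; move: (n.+1%:R^-1 : R) (n.+1%:R : R) => y x.
by case: ifP => _ ? ?; lra.
Qed.

Let not_subordinate theta : 0 <= theta < 1 -> ~ subordinate theta A B.
Proof.
move=> /andP[_ theta1] [_ [c c0 Bc]].
have [k ck] := linear_growth_unbounded c theta1.
(* At an odd index a n - m n = - n.+1 and - a n = - n.+1. *)
pose n := k.*2.+1.
have n_odd : odd n by rewrite /n /= odd_double.
have := Bc (basis R n) (diag_basis_dom _ _).
have nrmd d : nrm (diag d (basis R n)) = `|d n|.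
  by rewrite diag_basis nrmZ nrmR nrm_basis mulr1.
rewrite [nrm (B _)]nrmd [nrm (A _)]nrmd nrm_basis powR1 mulr1.
rewrite normrN /a /m n_odd [`|n.+1%:R|]ger0_norm ?ler0n//.
rewrite (_ : n.+1%:R - 2 * n.+1%:R = - n.+1%:R :> R); last by ring.
rewrite normrN ger0_norm ?ler0n// leNgt ck//.
by rewrite /n -addnn ltnW// ltnS leq_addr.
Qed.

Lemma ell2_example :
  (exists T, generates A T /\ uniformly_exponentially_stable T) /\
  exists B' : operator (ell2 R), [/\ linear_operator B', dom B' = dom A,
    relatively_bounded A B',
    forall theta : R, 0 <= theta < 1 -> ~ subordinate theta A B' &
    exists S, [/\ generates (op_add A B') S, strongly_stable S &
      ~ uniformly_exponentially_stable S]].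
Proof.
have a0 n : 0 <= a n by exact: le_trans ler01 (a_ge1 n).
have m0 n : 0 <= m n by exact: ltW.
have dom_diff := diag_dom_le diff_le.
split.
  exists (diag_semigroup a); split; first exact: diag_semigroup_generates.
  exact: diag_semigroup_exponentially_stable ltr01 a_ge1.
exists B; split => //.
- have [A0 Alin] := diag_op_linear (fun n => - a n).
  split=> // z u v Au Av; split; first exact: (Alin z u v Au Av).1.
  by have [_] := diag_linear z (dom_diff _ Au) (dom_diff _ Av).
- split => //; exists 1, 0; split => // u Au.
  by rewrite mul0r addr0; exact: nrm_diag_le.
exists (diag_semigroup m); split.
- apply: eq_generates (diag_semigroup_generates m0); first by rewrite /= dom_eq.
  move=> u mu; have au : diag_dom (fun n => - a n) u by rewrite dom_eq.
  apply: ell2P => n.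
  rewrite [LHS]diagE//.
  rewrite -[RHS]/(diag (fun n => - a n) u n + diag (fun n => a n - m n) u n).
  rewrite !diagE//; last exact: dom_diff.
  by rewrite -mulrDl -rmorphD; congr (_%:C * _); ring.
- exact: diag_semigroup_strongly_stable.
- apply: diag_semigroup_not_exponentially_stable => // e e0.
  (* At an even index m n = 1 / (n + 1), and Num.bound e^-1 exceeds 1 / e. *)
  exists (Num.bound e^-1).*2; rewrite /m odd_double.
  rewrite invf_plt ?posrE ?ltr0n//.
  have e1 : 0 <= e^-1 by rewrite invr_ge0 ltW.
  rewrite (lt_le_trans (archi_boundP e1))// ler_nat.
  by rewrite -addnn leqW// leq_addr.
Qed.

End counterexample.

Theorem mainTheorem9 (R : realType) :
  exists X : completeNormedModType R[i],
    reflexive_space X /\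
    exists family : set (operator X),
      family !=set0 /\
      forall A : operator X, family A ->
        (exists T : R -> X -> X,
           generates A T /\ uniformly_exponentially_stable T) /\
        exists B : operator X,
          [/\ linear_operator B,
              dom B = dom A,
              relatively_bounded A B,
              forall theta : R, 0 <= theta < 1 -> ~ subordinate theta A B &
              exists S : R -> X -> X,
                [/\ generates (op_add A B) S,
                    strongly_stable S &
                    ~ uniformly_exponentially_stable S]].
Proof.
exists (ell2 R); split; first exact: ell2_reflexive.
exists [set ell2_generator R]; split; first by exists (ell2_generator R).
by move=> _ ->; exact: ell2_example.
Qed.
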